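(* Let $n\ge1$ be an integer and $q\in(0,1)$. The antipodal $\mathbb{Z}/2$-action on the even quantum sphere $C(S^{2n}_q)$ satisfies $\mathrm{dim}^{\mathbb{Z}/2}_{\mathrm{LT}}(C(S^{2n}_q))\le2n$.
   Context: For $N\ge1$, $C(S^{2N-1}_q)$ is the universal $C^*$-algebra generated by $z_1,\ldots,z_N$ subject to: $z_jz_i=q\,z_iz_j$ for $i<j$; $z_j^*z_i=q\,z_iz_j^*$ for $i\ne j$; $z_i^*z_i=z_iz_i^*+(1-q^2)\sum_{j>i}z_jz_j^*$ for all $i$; and $z_1z_1^*+\cdots+z_Nz_N^*=1$. The even sphere $C(S^{2n}_q)$ is the quotient of $C(S^{2n+1}_q)$ by the relation $z_{n+1}=z_{n+1}^*$. The antipodal $\mathbb{Z}/2$-action is generated by $z_j\mapsto-z_j$ for all $j$. (By Hong--Szymański, $C(S^{2n}_q)$ is isomorphic to the graph $C^*$-algebra of the graph with vertices $v_1,\ldots,v_n,w_1,w_2$, edges $e_{ij}$ from $v_i$ to $v_j$ for $1\le i\le j\le n$, and edges $f_{ik}$ from $v_i$ to $w_k$ for $1\le i\le n$, $k\in\{1,2\}$; the antipodal action corresponds to $P_{v_i}\mapsto P_{v_i}$, $P_{w_k}\mapsto P_{w_{3-k}}$, $S_{e_{ij}}\mapsto-S_{e_{ij}}$, $S_{f_{ik}}\mapsto-S_{f_{i,3-k}}$.) Local-triviality dimension: let a compact group $G$ act on a unital $C^*$-algebra $A$. Equip $C(G)$ with $(\alpha_gf)(h)=f(hg)$ and $C_0((0,1])\otimes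 C(G)$ with the action on the second factor, and let $t$ be the identity function in $C_0((0,1])$. $\mathrm{dim}^G_{\mathrm{LT}}(A)$ is the smallest $m\ge0$ for which there exist $G$-equivariant $*$-homomorphisms $\rho_0,\ldots,\rho_m:C_0((0,1])\otimes C(G)\to A$ with $\sum_{i=0}^m\rho_i(t\otimes1)=1$ ($\infty$ if no such $m$ exists). *)

(* Defs.v *)
From HB Require Import structures.
From mathcomp Require Import all_boot all_order all_algebra all_fingroup.
From mathcomp Require Import complex.
From mathcomp Require Import all_classical all_reals all_analysis.

Set Implicit Arguments.
Unset Strict Implicit.
Unset Printing Implicit Defensive.

Import Order.TTheory GRing.Theory Num.Theory.
Import numFieldNormedType.Exports.

Local Open Scope classical_set_scope.
Local Open Scope ring_scope.

Reserved Notation "x ** y" (at level 40, left associativity).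
Reserved Notation "x ^*s" (at level 1, format "x ^*s").

(* Complex *-algebras, not necessarily unital: C_0((0,1]) (x) C(G) has no
   unit, whereas the algType of MathComp requires one. *)
HB.mixin Record isStarAlgebra (R : realType) A of GRing.Lmodule R[i] A := {
  smul : A -> A -> A;
  star : A -> A;
  smulA : associative smul;
  smulDl : left_distributive smul +%R;
  smulDr : right_distributive smul +%R;
  smulZl : forall (c : R[i]) x y, smul (c *: x) y = c *: smul x y;
  smulZr : forall (c : R[i]) x y, smul x (c *: y) = c *: smul x y;
  starK : involutive star;
  starD : {morph star : x y / x + y};
  starZ : forall (c : R[i]) x, star (c *: x) = (c^*)%C *: star x;
  starM : forall x y, star (smul x y) = smul (star y) (star x)
}.

#[short(type="starAlgType")]
HB.structure Definition StarAlgebra (R : realType) :=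
  {A of isStarAlgebra R A & GRing.Lmodule R[i] A}.

Notation "x ** y" := (smul x y) : ring_scope.
Notation "x ^*s" := (star x) : ring_scope.

(* The norm of a normedModType R[i] takes (real) values in R[i]. *)
HB.mixin Record isUnitalCStar (R : realType) A
    of CompleteNormedModule R[i] A & StarAlgebra R A := {
  sone : A;
  smul1l : left_id sone (@smul R A);
  smul1r : right_id sone (@smul R A);
  norm_smul_le : forall x y : A, `|x ** y| <= `|x| * `|y|;
  cstar_identity : forall x : A, `|x^*s ** x| = `|x| ^+ 2
}.

#[short(type="cstarAlgType")]
HB.structure Definition CStarAlgebra (R : realType) :=
  {A of isUnitalCStar R A & CompleteNormedModule R[i] A & StarAlgebra R A}.

Definition star_hom (R : realType) (A B : starAlgType R) (f : A -> B) : Prop :=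
  [/\ linear f, {morph f : x y / x ** y} & {morph f : x / x^*s}].

Definition unital_star_hom (R : realType) (A B : cstarAlgType R) (f : A -> B) :
    Prop :=
  star_hom f /\ f sone = sone.

Section CStar.
Variable R : realType.
Implicit Types A B : cstarAlgType R.

Definition closed_star_subalgebra A (D : set A) : Prop :=
  [/\ closed D,
      D 0 /\ (forall (c : R[i]) x y, D x -> D y -> D (c *: x + y)),
      (forall x y, D x -> D y -> D (x ** y))
    & (forall x, D x -> D x^*s)].

Definition cstar_generated A (I : Type) (z : I -> A) : Prop :=
  forall D : set A,
    closed_star_subalgebra D -> (forall i, D (z i)) -> D = setT.

(* Scalars need no separate clause: c *: x = (c *: sone) ** x. *)
Definition closed_ideal A (J : set A) : Prop :=
  [/\ closed J, J 0, (forall x y, J x -> J y -> J (x + y))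
    & (forall a x, J x -> J (a ** x) /\ J (x ** a))].

Definition closed_ideal_gen A (x : A) : set A :=
  \bigcap_(J in [set J : set A | closed_ideal J /\ J x]) J.

Section QuantumSpheres.
Variable q : R.

(* Indices are shifted: z_1, ..., z_N are z 0, ..., z N.-1. *)
Definition qsphere_rel N A (z : 'I_N -> A) : Prop :=
  [/\ (forall i j : 'I_N, (i < j)%N -> z j ** z i = q%:C%C *: (z i ** z j)),
      (forall i j : 'I_N,
         i != j -> (z j)^*s ** z i = q%:C%C *: (z i ** (z j)^*s)),
      (forall i : 'I_N,
         (z i)^*s ** z i =
           z i ** (z i)^*s +
           (1 - q ^+ 2)%:C%C *: \sum_(j < N | (i < j)%N) z j ** (z j)^*s)
    & \sum_(i < N) z i ** (z i)^*s = sone].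

(* A, with the elements z, is the universal C*-algebra C(S_q^{2N-1}).  The
   comparison map f is unique because z generates A. *)
Definition is_odd_qsphere N A (z : 'I_N -> A) : Prop :=
  [/\ qsphere_rel z, cstar_generated z
    & forall (B : cstarAlgType R) (y : 'I_N -> B), qsphere_rel y ->
        exists f : A -> B, unital_star_hom f /\ (forall i, f (z i) = y i)].

(* A is the quotient C(S_q^{2n}) of B = C(S_q^{2n+1}) by the closed ideal
   generated by z_{n+1} - z_{n+1}^*; x is the image of the generators. *)
Definition is_even_qsphere n A (x : 'I_n.+1 -> A) : Prop :=
  exists (B : cstarAlgType R) (z : 'I_n.+1 -> B) (p : B -> A),
    [/\ is_odd_qsphere z,
        unital_star_hom p /\ (forall a, exists b, p b = a),
        [set b | p b = 0] = closed_ideal_gen (z ord_max - (z ord_max)^*s)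
      & forall i, p (z i) = x i].

End QuantumSpheres.

(* G is finite, hence discrete: continuity of g |-> alpha g a is automatic. *)
Definition cstar_action (G : finGroupType) A (alpha : G -> A -> A) : Prop :=
  [/\ (forall g, unital_star_hom (alpha g)), (forall a, alpha 1%g a = a)
    & (forall g h a, alpha (g * h)%g a = alpha g (alpha h a))].

(* The group law of 'Z_2 is addition, so its non-trivial element is 1%R. *)
Definition antipodal_action N A (x : 'I_N -> A) (alpha : 'Z_2 -> A -> A) :
    Prop :=
  cstar_action alpha /\ (forall j, alpha (1%R : 'Z_2) (x j) = - x j).

End CStar.

(* C_0((0,1]) is {f in C([0,1]) | f 0 = 0}; its elements are extended by 0
   to R so that Leibniz equality is equality of functions on (0,1]. *)
Definition is_C0 (R : realType) (f : R -> R[i]) : Prop :=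
  {within `[0%R, 1%R], continuous (f : R -> R[i]^o)} /\
  (forall x, ~~ (0 < x <= 1) -> f x = 0).

Definition C0_pred (R : realType) : {pred (R -> R[i])} :=
  [pred f | `[< is_C0 f >]].

Section C0Closed.
Variable R : realType.
Implicit Types f g : R -> R[i].

Lemma C0_submod_closed : submod_closed (@C0_pred R).
Proof.
split=> [|c f g /asboolP[cf f0] /asboolP[cg g0]]; apply/asboolP.
  by split=> // x; exact: cst_continuous.
split=> [x|x hx]; last first.
  by rewrite !fctE f0 // g0 // scaler0 addr0.
apply: (@continuousD R[i] R[i]^o); last exact: cg.
by apply: (@continuousZl_tmp R[i] R[i]^o); exact: cf.
Qed.

HB.instance Definition _ :=
  GRing.isSubmodClosed.Build R[i] (R -> R[i]) (@C0_pred R) C0_submod_closed.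

Lemma is_C0M f g : is_C0 f -> is_C0 g -> is_C0 (fun x => f x * g x).
Proof.
move=> [cf f0] [cg g0]; split=> [x|x hx]; last by rewrite f0 // mul0r.
by apply: (@continuousM R[i]); [exact: cf|exact: cg].
Qed.

Lemma conjc_continuous : continuous (fun c : R[i]^o => (c^*)%C : R[i]^o).
Proof.
move=> c; pose F := nbhs (c : R[i]^o).
have FF : Filter F by exact: nbhs_filter.
apply: (@cvgrPdist_le R[i] R[i]^o R[i]^o F FF _ _).2 => e e0.
have H := (@cvgrPdist_le R[i] R[i]^o R[i]^o F FF idfun c).1 cvg_id e e0.
by apply: (filterS _ H) => d; rewrite -rmorphB normcJ.
Qed.

Lemma is_C0_conj f : is_C0 f -> is_C0 (fun x => (f x)^*%C).
Proof.
move=> [cf f0]; split=> [x|x hx]; last by rewrite f0 // conjc0.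
exact: (@continuous_comp _ R[i]^o R[i]^o _ _ x (cf x) (@conjc_continuous _)).
Qed.

Lemma real_complex_continuous :
  continuous (fun x : R => x%:C%C : R[i]^o).
Proof.
move=> x; pose F := nbhs x.
have FF : Filter F by exact: nbhs_filter.
apply: (@cvgrPdist_le R[i] R[i]^o R F FF _ _).2 => -[e e'].
rewrite ltcE /= => /andP[/eqP-> e0].
have H := (@cvgrPdist_le R R R F FF idfun x).1 cvg_id _ e0.
apply: (filterS _ H) => y hy.
by rewrite -rmorphB normc_def /= expr0n addr0 sqrtr_sqr lecR.
Qed.

Lemma is_C0_id : is_C0 (fun x : R => if 0 < x <= 1 then x%:C%C else 0).
Proof.
split=> [|x hx]; last by rewrite (negbTE hx).
apply: (@subspace_eq_continuous _ _ _ (fun x : R => x%:C%C : R[i]^o)).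
  move=> x /set_mem /=; rewrite in_itv /= => /andP[x0 x1].
  rewrite /from_subspace x1 andbT; case: ltP => // x0'.
  by have -> : x = 0 by apply/le_anti; rewrite x0 x0'.
by apply: continuous_subspaceT => x; exact: real_complex_continuous.
Qed.

End C0Closed.

(* The *-algebra C_0((0,1]), with pointwise operations. *)
Record C0_itv (R : realType) := MkC0 {
  C0_fun :> R -> R[i];
  _ : C0_fun \in @C0_pred R
}.

HB.instance Definition _ (R : realType) := [isSub for @C0_fun R].
HB.instance Definition _ (R : realType) := [Choice of C0_itv R by <:].
HB.instance Definition _ (R : realType) :=
  [SubChoice_isSubLmodule of C0_itv R by <:].

Section C0StarAlgebra.
Variable R : realType.
Implicit Types f g : C0_itv R.

Lemma C0P f : is_C0 f.
Proof. exact: (asboolW (valP f)). Qed.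

Definition C0_mul f g : C0_itv R := MkC0 (asboolT (is_C0M (C0P f) (C0P g))).
Definition C0_conj f : C0_itv R := MkC0 (asboolT (is_C0_conj (C0P f))).
Definition C0_id : C0_itv R := MkC0 (asboolT (@is_C0_id R)).

Lemma C0_eq f g : (forall x, f x = g x) -> f = g.
Proof. by move=> fg; apply/val_inj/funext. Qed.

Let mulA : associative C0_mul.
Proof. by move=> f g h; apply: C0_eq => x; exact: mulrA. Qed.
Let mulDl : left_distributive C0_mul +%R.
Proof. by move=> f g h; apply: C0_eq => x; exact: mulrDl. Qed.
Let mulDr : right_distributive C0_mul +%R.
Proof. by move=> f g h; apply: C0_eq => x; exact: mulrDr. Qed.
Let mulZl (c : R[i]) f g : C0_mul (c *: f) g = c *: C0_mul f g.
Proof. by apply: C0_eq => x /=; rewrite /= -mulrA. Qed.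
Let mulZr (c : R[i]) f g : C0_mul f (c *: g) = c *: C0_mul f g.
Proof. by apply: C0_eq => x; exact: mulrCA. Qed.
Let conjK : involutive C0_conj.
Proof. by move=> f; apply: C0_eq => x; exact: conjcK. Qed.
Let conjD : {morph C0_conj : f g / f + g}.
Proof. by move=> f g; apply: C0_eq => x; exact: (rmorphD (@conjc R)). Qed.
Let conjZ (c : R[i]) f : C0_conj (c *: f) = (c^*)%C *: C0_conj f.
Proof. by apply: C0_eq => x; exact: (rmorphM (@conjc R)). Qed.
Let conjM f g : C0_conj (C0_mul f g) = C0_mul (C0_conj g) (C0_conj f).
Proof. by apply: C0_eq => x /=; rewrite mulrC; exact: (rmorphM (@conjc R)). Qed.

HB.instance Definition _ := isStarAlgebra.Build R (C0_itv R)
  mulA mulDl mulDr mulZl mulZr conjK conjD conjZ conjM.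

End C0StarAlgebra.

(* For finite G, the pointwise *-algebra V^G is V (x) C(G). *)
Section TensorCG.
Variables (R : realType) (V : starAlgType R) (G : finType).

Definition ffun_smul (f g : {ffun G -> V}) := [ffun h => f h ** g h].
Definition ffun_star (f : {ffun G -> V}) := [ffun h => (f h)^*s].

Let mulA : associative ffun_smul.
Proof. by move=> f g h; apply/ffunP => x; rewrite !ffunE smulA. Qed.
Let mulDl : left_distributive ffun_smul +%R.
Proof. by move=> f g h; apply/ffunP => x; rewrite !ffunE smulDl. Qed.
Let mulDr : right_distributive ffun_smul +%R.
Proof. by move=> f g h; apply/ffunP => x; rewrite !ffunE smulDr. Qed.
Let mulZl (c : R[i]) f g : ffun_smul (c *: f) g = c *: ffun_smul f g.
Proof. by apply/ffunP => x; rewrite !ffunE smulZl. Qed.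
Let mulZr (c : R[i]) f g : ffun_smul f (c *: g) = c *: ffun_smul f g.
Proof. by apply/ffunP => x; rewrite !ffunE smulZr. Qed.
Let fstarK : involutive ffun_star.
Proof. by move=> f; apply/ffunP => x; rewrite !ffunE starK. Qed.
Let fstarD : {morph ffun_star : f g / f + g}.
Proof. by move=> f g; apply/ffunP => x; rewrite !ffunE starD. Qed.
Let fstarZ (c : R[i]) f : ffun_star (c *: f) = (c^*)%C *: ffun_star f.
Proof. by apply/ffunP => x; rewrite !ffunE starZ. Qed.
Let fstarM f g : ffun_star (ffun_smul f g) = ffun_smul (ffun_star g) (ffun_star f).
Proof. by apply/ffunP => x; rewrite !ffunE starM. Qed.

HB.instance Definition _ := isStarAlgebra.Build R {ffun G -> V}
  mulA mulDl mulDr mulZl mulZr fstarK fstarD fstarZ fstarM.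

Definition tensor (v : V) (c : G -> R[i]) : {ffun G -> V} :=
  [ffun h => c h *: v].

End TensorCG.

Section LocalTrivialityDimension.
Variables (R : realType) (G : finGroupType) (A : cstarAlgType R).
Variable alpha : G -> A -> A.

Definition cone_algebra : starAlgType R := {ffun G -> C0_itv R}.

Definition cone_action (g : G) (f : cone_algebra) : cone_algebra :=
  [ffun h => f (h * g)%g].

Definition equivariant_hom (rho : cone_algebra -> A) : Prop :=
  star_hom rho /\ forall g f, rho (cone_action g f) = alpha g (rho f).

Definition LT_trivial_in (m : nat) : Prop :=
  exists rho : 'I_m.+1 -> cone_algebra -> A,
    (forall i, equivariant_hom (rho i)) /\
    \sum_(i < m.+1) rho i (tensor (C0_id R) (fun=> 1)) = sone.

(* The least such m, and +oo if there is none. *)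
Definition dim_LT : \bar R :=
  ereal_inf [set (m%:R)%:E | m in [set m | LT_trivial_in m]].

End LocalTrivialityDimension.

(* Main.v *)
From HB Require Import structures.
Require Import Defs.
From mathcomp Require Import all_boot all_order all_algebra.
From mathcomp Require Import complex.
From mathcomp Require Import all_classical all_reals all_analysis.
From mathcomp Require Import ring lra.
Set Implicit Arguments.
Unset Strict Implicit.
Unset Printing Implicit Defensive.
Import Order.TTheory GRing.Theory Num.Theory.
Import numFieldNormedType.Exports.
Local Open Scope classical_set_scope.
Local Open Scope ring_scope.

(** Write x_0, ..., x_n for the generators and c_j = ((1 + q^2) / 2)^j. The
    relations give x_j^* x_j = x_j x_j^* + (1 - q^2) (the tail of the sphere
    relation after j), so the squares of the odd self-adjoint elements
    sqrt c_j Re x_j, sqrt c_j Im x_j (j < n) and sqrt c_n x_n telescope to 1.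

    An odd self-adjoint g with |g| <= 1 has orthogonal positive and negative
    parts g_+ and g_-, exchanged by the action. With a = g_+^2 and b = g_-^2,
    the map (f_0, f_1) |-> f_0(a) + f_1(b) is an equivariant homomorphism which
    sends t (x) 1 to a + b = g^2.

    The functional calculus f |-> f(a), for 0 <= a <= 1, is the limit of the
    Bernstein polynomials of f at a. As |f s - f t| <= e + C (s - t)^2, the
    variance of the binomial law bounds all the errors, so that no spectral
    theory is needed beyond square roots of positive elements. *)

(** * The real norm of a C*-algebra *)

Section CStarTheory.
Variables (R : realType) (A : cstarAlgType R).
Implicit Types (x y z u v : A) (c : R[i]) (r s M : R).

(* Only a pzRingType: the zero algebra is allowed. *)
#[non_forgetful_inheritance]
HB.instance Definition _ := GRing.Zmodule_isPzRing.Build A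
  (@smulA R A) (@smul1l R A) (@smul1r R A) (@smulDl R A) (@smulDr R A).

Lemma smulE x y : x ** y = x * y. Proof. by []. Qed.

Lemma scaleAl c x y : c *: x * y = c *: (x * y).
Proof. exact: smulZl. Qed.

Lemma scaleAr c x y : x * (c *: y) = c *: (x * y).
Proof. exact: smulZr. Qed.

Lemma starMr x y : (x * y)^*s = y^*s * x^*s.
Proof. exact: starM. Qed.

Lemma star0 : (0 : A)^*s = 0.
Proof. by rewrite -(scale0r (0 : A)) starZ (rmorph0 (@conjc R)) !scale0r. Qed.

Lemma starN x : (- x)^*s = - x^*s.
Proof. by rewrite -scaleN1r starZ (rmorphN1 (@conjc R)) scaleN1r. Qed.

Lemma starB x y : (x - y)^*s = x^*s - y^*s.
Proof. by rewrite starD starN. Qed.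

Lemma star1 : (1 : A)^*s = 1.
Proof. by rewrite -[LHS]mulr1 -{2}(starK (1 : A)) -starMr mulr1 starK. Qed.

Lemma starZr r x : (r%:C%C *: x)^*s = r%:C%C *: x^*s.
Proof. by rewrite starZ conjc_real. Qed.

Lemma commZ c x y : GRing.comm x y -> GRing.comm x (c *: y).
Proof. by move=> xy; rewrite /GRing.comm scaleAl scaleAr xy. Qed.

(** The norm of the structure is a real element of [R[i]], so its real part loses nothing and lies
    in a totally ordered field. *)
Definition nrm x : R := complex.Re `|x|.

Lemma nrmE x : `|x| = (nrm x)%:C%C.
Proof. by rewrite RRe_real // normr_real. Qed.

Lemma nrm_ge0 x : 0 <= nrm x.
Proof. by rewrite -(lecR (R := R)) -nrmE normr_ge0. Qed.

Lemma nrmD x y : nrm (x + y) <= nrm x + nrm y.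
Proof. by have := ler_normD x y; rewrite !nrmE -rmorphD lecR. Qed.

Lemma nrmN x : nrm (- x) = nrm x.
Proof. by rewrite /nrm normrN. Qed.

Lemma nrm0 : nrm 0 = 0.
Proof. by rewrite /nrm normr0. Qed.

Lemma nrm_eq0 x : nrm x = 0 -> x = 0.
Proof. by move=> x0; apply/eqP; rewrite -normr_eq0 nrmE x0. Qed.

Lemma nrmM x y : nrm (x * y) <= nrm x * nrm y.
Proof. by have := norm_smul_le x y; rewrite !nrmE -rmorphM lecR. Qed.

Lemma nrmZ c x : nrm (c *: x) = complex.Re `|c| * nrm x.
Proof.
apply: (@complexI R); have := normrZ c x.
by rewrite !nrmE -(RRe_real (normr_real c)) -rmorphM.
Qed.

Lemma nrmZr r x : nrm (r%:C%C *: x) = `|r| * nrm x.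
Proof. by rewrite nrmZ normc_def /= expr0n addr0 sqrtr_sqr. Qed.

Lemma nrmZi x : nrm ('i%C *: x) = nrm x.
Proof. by rewrite nrmZ normc_def /= expr0n expr1n add0r sqrtr1 mul1r. Qed.

Lemma nrm_starM x : nrm (x^*s * x) = nrm x ^+ 2.
Proof.
by have := cstar_identity x; rewrite !nrmE -rmorphXn => /complexI.
Qed.

(** The C*-identity gives |y|^2 <= |y^*| |y|; cancel |y|, then take y to be [x] and [x^*s]. *)
Lemma nrm_star x : nrm x^*s = nrm x.
Proof.
have le y : nrm y <= nrm y^*s.
  have := nrmM y^*s y; rewrite nrm_starM expr2.
  have := nrm_ge0 y; rewrite le_eqVlt => /predU1P[<- _|y0].
    exact: nrm_ge0.
  by rewrite ler_pM2r.
by apply/le_anti; rewrite le andbT -{2}(starK x) le.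
Qed.

Lemma nrm_sqr x : x^*s = x -> nrm (x * x) = nrm x ^+ 2.
Proof. by move=> xs; rewrite -nrm_starM xs. Qed.

Lemma nrm1_le1 : nrm 1 <= 1.
Proof.
have := nrm_sqr star1; rewrite mulr1 => n1.
by have := nrm_ge0 1; nra.
Qed.

Lemma nrmZ1 r : 0 <= r -> nrm (r%:C%C *: (1 : A)) <= r.
Proof. by move=> r0; rewrite nrmZr ger0_norm // ler_piMr ?nrm1_le1. Qed.

Lemma cvg_nrm (u : nat -> A) x :
  (forall e, 0 < e -> exists N, forall n, (N <= n)%N -> nrm (u n - x) <= e) <->
  u @ \oo --> x.
Proof.
rewrite (@cvgrPdistC_le R[i] A nat \oo _ u x); split=> H.
  move=> -[e e']; rewrite ltcE /= => /andP[/eqP -> e0].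
  have [N HN] := H _ e0; exists N => // n /= Nn.
  by rewrite nrmE lecR HN.
move=> e e0; have [|N _ HN] := H e%:C%C; first by rewrite ltcR.
by exists N => n Nn; have := HN n Nn; rewrite /= nrmE lecR.
Qed.

Lemma nrm_cauchy_cvg (u : nat -> A) :
  (forall e, 0 < e -> exists N, forall m n, (N <= m)%N -> (N <= n)%N ->
    nrm (u m - u n) <= e) -> cvgn u.
Proof.
move=> H; apply: cauchy_cvg; apply: cauchy_exP => -[e e'].
rewrite ltcE /= => /andP[/eqP -> e0].
have [|N HN] := H (e / 2); first by rewrite divr_gt0.
exists (u N); exists N => // n /= Nn.
rewrite /= -ball_normE /= nrmE ltcR (le_lt_trans (HN _ _ _ Nn)) //.
by rewrite ltr_pdivrMr // ltr_pMr // ltr1n.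
Qed.

End CStarTheory.

(** * Square roots *)

Section SquareRoot.
Variables (R : realType) (A : cstarAlgType R).
Implicit Types (x y z u v : A) (r s M : R).

Lemma cvg_mulA (u v : nat -> A) x y :
  u @ \oo --> x -> v @ \oo --> y -> (fun n => u n * v n) @ \oo --> x * y.
Proof.
move=> /cvg_nrm ux /cvg_nrm vy; apply/cvg_nrm => e e0.
have xy0 : 0 < 1 + nrm x + nrm y by have := nrm_ge0 x; have := nrm_ge0 y; lra.
(* As d <= 1, the product of the two errors is at most d, so the total error is at most d (1 + |x| +
   |y|) <= e. *)
pose d := Num.min 1 (e / (1 + nrm x + nrm y)).
have d0 : 0 < d by rewrite lt_min ltr01 divr_gt0.
have [N HN] := ux _ d0; have [N' HN'] := vy _ d0.
exists (maxn N N') => n; rewrite geq_max => /andP[/HN un /HN' vn].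
have -> : u n * v n - x * y =
    (u n - x) * (v n - y) + ((u n - x) * y + x * (v n - y)).
  by rewrite mulrBr addrA addrNK mulrBr mulrBl addrA subrK.
have d1 : d <= 1 by rewrite ge_min lexx.
have de : d * (1 + nrm x + nrm y) <= e.
  by rewrite -ler_pdivlMr // ge_min lexx orbT.
apply: (le_trans (nrmD _ _)); apply: le_trans de.
have := nrmD ((u n - x) * y) (x * (v n - y)).
have := nrmM (u n - x) (v n - y); have := nrmM (u n - x) y.
have := nrmM x (v n - y).
have := nrm_ge0 (u n - x); have := nrm_ge0 (v n - y).
have := nrm_ge0 x; have := nrm_ge0 y; nra.
Qed.

Lemma cvg_star (u : nat -> A) x :
  u @ \oo --> x -> (fun n => (u n)^*s) @ \oo --> x^*s.
Proof.
move=> /cvg_nrm ux; apply/cvg_nrm => e /ux[N HN].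
by exists N => n /HN; rewrite -starB nrm_star.
Qed.

Lemma cvgA_unique (u : nat -> A) x y : u @ \oo --> x -> u @ \oo --> y -> x = y.
Proof. exact: (cvg_unique (@norm_hausdorff _ A)). Qed.

(* [w = u + i v] satisfies [w^* w = u^2 + v^2] and [u] is its real part. *)
Lemma nrm_le_sqrD u v M : u^*s = u -> v^*s = v -> GRing.comm u v -> 0 <= M ->
  u * u + v * v = (M ^+ 2)%:C%C *: (1 : A) -> nrm u <= M.
Proof.
move=> us vs uv M0 uvM; pose w := u + 'i%C *: v.
have ws : w^*s = u - 'i%C *: v.
  rewrite starD starZ us vs (_ : ('i%C^*)%C = - 'i%C) ?scaleNr //.
  by apply/eqP; rewrite eq_complex /= oppr0 !eqxx.
have ww : w^*s * w = (M ^+ 2)%:C%C *: (1 : A).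
  rewrite ws mulrBl !mulrDr !scaleAr !scaleAl scalerA -uvM -uv.
  rewrite (_ : 'i%C * 'i%C = -1) -?expr2 ?sqr_i // scaleN1r.
  by rewrite opprB [v * v - _]addrC addrA addrK.
have wM : nrm w <= M.
  have := nrmZ1 A (sqr_ge0 M).
  by rewrite -ww nrm_starM; have := nrm_ge0 w; nra.
have := nrmD w w^*s; rewrite nrm_star.
rewrite (_ : w + w^*s = (2%:R : R)%:C%C *: u).
  by rewrite nrmZr normr_nat; lra.
rewrite ws addrACA subrr addr0.
by rewrite rmorph_nat scaler_nat mulr2n.
Qed.

(* A fixed point [w = (y + w^2) / 2] satisfies [(1 - w)^2 = 1 - y]. *)
Fixpoint sqrt_iter y n : A :=
  if n is n'.+1 then
    (2^-1)%:C%C *: (y + sqrt_iter y n' * sqrt_iter y n')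
  else 0.

(* The same iteration at [y = 1] majorizes the increments for [|y| <= 1]. *)
Fixpoint sqrt_bound n : R :=
  if n is n'.+1 then 2^-1 * (1 + sqrt_bound n' ^+ 2) else 0.

Lemma sqrt_bound_itv n : 0 <= sqrt_bound n <= 1.
Proof. by elim: n => [|n /andP[]] /=; [rewrite lexx ler01|nra]. Qed.

Lemma sqrt_bound_le n : sqrt_bound n <= sqrt_bound n.+1.
Proof. by have := sqrt_bound_itv n => /=; nra. Qed.

Lemma sqrt_bound_cauchy e : 0 < e -> exists N, forall m n, (N <= m)%N ->
  (m <= n)%N -> sqrt_bound n - sqrt_bound m <= e.
Proof.
move=> e0.
have nd : {homo sqrt_bound : n m / (n <= m)%N >-> n <= m}.
  by apply/nondecreasing_seqP => n; exact: sqrt_bound_le.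
have /cvgrPdist_le/(_ _ e0)[N _ HN] : sqrt_bound @ \oo --> limn sqrt_bound.
  apply: nondecreasing_is_cvgn => //; exists 1 => _ [n _ <-].
  by have /andP[] := sqrt_bound_itv n.
have sl n : sqrt_bound n <= limn sqrt_bound.
  apply: nondecreasing_cvgn_le => //; apply: nondecreasing_is_cvgn => //.
  by exists 1 => _ [k _ <-]; have /andP[] := sqrt_bound_itv k.
exists N => m n Nm mn; have := HN m Nm; rewrite ler_norml => /andP[_].
by have := sl n; lra.
Qed.

Lemma comm_sqrt_iter y z n : GRing.comm z y -> GRing.comm z (sqrt_iter y n).
Proof.
move=> zy; elim: n => [|n IH] /=; first exact: commr0.
by apply: commZ; apply: commrD => //; exact: commrM.
Qed.

Section Convergence.
Variable y : A.
Hypothesis y1 : nrm y <= 1.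
Let w := sqrt_iter y.

Lemma nrm_sqrt_iter n : nrm (w n) <= sqrt_bound n.
Proof.
elim: n => [|n IH] /=; first by rewrite nrm0.
rewrite nrmZr ger0_norm ?invr_ge0 ?ler0n //.
rewrite ler_wpM2l ?invr_ge0 ?ler0n // (le_trans (nrmD _ _)) // lerD //.
apply: le_trans (nrmM _ _) _; rewrite -expr2 ler_sqr ?nnegrE ?nrm_ge0 //.
by have /andP[] := sqrt_bound_itv n.
Qed.

(** Increments satisfy w_{m+2} - w_{m+1} = (w_{m+1} + w_m) (w_{m+1} - w_m) / 2, and the bounds obey
    the same recursion. This covers |y| = 1, where no geometric rate is available. *)
Lemma nrm_sqrt_iterB n k :
  nrm (w (n + k) - w n) <= sqrt_bound (n + k) - sqrt_bound n.
Proof.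
have wS m : w m.+1 = (2^-1)%:C%C *: (y + w m * w m) by [].
have step m : nrm (w m.+1 - w m) <= sqrt_bound m.+1 - sqrt_bound m.
  elim: m => [|m IH]; first by rewrite !subr0; exact: nrm_sqrt_iter.
  have ww : GRing.comm (w m.+1) (w m).
    by apply/comm_sqrt_iter/commr_sym/comm_sqrt_iter.
  have -> : w m.+2 - w m.+1
      = (2^-1)%:C%C *: ((w m.+1 + w m) * (w m.+1 - w m)).
    rewrite (wS m.+1) {3}(wS m) -scalerBr opprD addrACA subrr add0r.
    by rewrite mulrBr !mulrDl ww opprD addrA addrK.
  rewrite nrmZr ger0_norm ?invr_ge0 ?ler0n //.
  set p := w m.+1 + w m; set d := w m.+1 - w m in IH *.
  have pb : nrm p <= sqrt_bound m.+1 + sqrt_bound m.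
    by apply: le_trans (nrmD _ _) _; rewrite lerD ?nrm_sqrt_iter.
  have pd := ler_pM (nrm_ge0 p) (nrm_ge0 d) pb IH.
  have bS j : sqrt_bound j.+1 = 2^-1 * (1 + sqrt_bound j ^+ 2) by [].
  move: pd (nrmM p d) (bS m.+1) (bS m).
  set b := sqrt_bound m; set b1 := sqrt_bound m.+1; set b2 := sqrt_bound m.+2.
  nra.
elim: k => [|k IH]; first by rewrite addn0 !subrr nrm0.
rewrite addnS -(subrK (w (n + k)) (w _.+1)) -addrA.
have := nrmD (w (n + k).+1 - w (n + k)) (w (n + k) - w n).
by have := step (n + k)%N; lra.
Qed.

Lemma sqrt_iter_cvg : cvgn w.
Proof.
apply: nrm_cauchy_cvg => e /sqrt_bound_cauchy[N HN]; exists N => m n Nm Nn.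
wlog mn : m n Nm Nn / (n <= m)%N => [H|].
  have [/H|/ltnW mn] := leqP n m; first exact.
  by rewrite -opprB nrmN; apply: H.
rewrite -(subnKC mn); apply: le_trans (nrm_sqrt_iterB _ _) _.
by rewrite subnKC //; exact: HN.
Qed.

End Convergence.

Definition sqrt1B y : A := 1 - limn (sqrt_iter y).

Section Properties.
Variable y : A.
Hypotheses (y1 : nrm y <= 1).

Lemma sqrt1B_sqr : sqrt1B y * sqrt1B y = 1 - y.
Proof.
have wl := sqrt_iter_cvg y1; set l := limn _ in wl.
have : l = (2^-1)%:C%C *: (y + l * l).
  have wl' : (sqrt_iter y n.+1) @[n --> \oo] --> l by rewrite cvg_shiftS.
  apply: (cvgA_unique wl'); apply: cvgZl_tmp; apply: cvgD; first exact: cvg_cst.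
  exact: cvg_mulA.
rewrite /sqrt1B -/l => {wl} /(congr1 (fun z => (2%:R : R)%:C%C *: z)).
rewrite scalerA -rmorphM divff ?pnatr_eq0 // scale1r.
rewrite rmorph_nat scaler_nat mulr2n => ll.
rewrite mulrBl mul1r mulrBr mulr1 opprB -addrA; congr (_ + _).
by rewrite addrCA -opprD ll opprD addrC subrK.
Qed.

(** The iterates are polynomials in [y], and commutation passes to the limit. *)
Lemma sqrt1B_comm z : GRing.comm z y -> GRing.comm z (sqrt1B y).
Proof.
move=> zy; apply: commrB; first exact: commr1.
have wl := sqrt_iter_cvg y1.
apply: (@cvgA_unique (fun n => z * sqrt_iter y n)).
  by apply: cvg_mulA => //; exact: cvg_cst.
under eq_fun do rewrite (comm_sqrt_iter _ zy).
by apply: cvg_mulA => //; exact: cvg_cst.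
Qed.

Lemma sqrt1B_star : y^*s = y -> (sqrt1B y)^*s = sqrt1B y.
Proof.
move=> ys; rewrite starB star1; congr (_ - _).
have wl := sqrt_iter_cvg y1.
apply: (cvgA_unique (cvg_star wl)).
have ws n : (sqrt_iter y n)^*s = sqrt_iter y n.
  elim: n => [|n IH] /=; first exact: star0.
  by rewrite starZr starD starMr ys IH.
by under eq_fun do rewrite ws.
Qed.

End Properties.
End SquareRoot.

(** * Positive elements *)

Section Positivity.
Variables (R : realType) (A : cstarAlgType R).
Implicit Types (x y z u v : A) (r s M : R).

(* For self-adjoint [x], the norm condition says that the spectrum of [x] lies
   in [[0, 2 M]]; sums of positive elements are then obviously positive. *)
Definition posn x :=
  x^*s = x /\ exists2 M, 0 <= M & nrm (M%:C%C *: (1 : A) - x) <= M.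

Lemma posn_bound x : posn x -> exists2 M, 0 <= M &
  forall M', M <= M' -> nrm (M'%:C%C *: (1 : A) - x) <= M'.
Proof.
move=> [xs [M M0 xM]]; exists M => // M' MM'.
rewrite -(subrK M M') rmorphD scalerDl -addrA.
apply: le_trans (nrmD _ _) _; apply: lerD => //.
by apply: nrmZ1; rewrite subr_ge0.
Qed.

Lemma posn0 : posn 0.
Proof. by split; [exact: star0|exists 0; rewrite // scale0r subr0 nrm0]. Qed.

Lemma posnD x y : posn x -> posn y -> posn (x + y).
Proof.
move=> [xs [M M0 xM]] [ys [M' M'0 yM]]; split; first by rewrite starD xs ys.
exists (M + M'); first exact: addr_ge0.
rewrite rmorphD scalerDl opprD addrACA.
by apply: le_trans (nrmD _ _) (lerD _ _).
Qed.

Lemma posnZ r x : 0 <= r -> posn x -> posn (r%:C%C *: x).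
Proof.
move=> r0 [xs [M M0 xM]]; split; first by rewrite starZr xs.
exists (r * M); first exact: mulr_ge0.
by rewrite rmorphM -scalerA -scalerBr nrmZr ger0_norm // ler_wpM2l.
Qed.

(** For M > |v|^2 the root u of M - v^2 commutes with v and u^2 + v^2 = M, hence |M - v^2| = |u|^2
    <= M. *)
Lemma posn_sqr v : v^*s = v -> posn (v * v).
Proof.
move=> vs; split; first by rewrite starMr vs.
pose M := nrm v ^+ 2 + 1; have M0 : 0 < M by rewrite ltr_wpDl ?sqr_ge0.
exists M; first exact: ltW.
pose y := (M^-1)%:C%C *: (v * v).
have y1 : nrm y <= 1.
  rewrite nrmZr ger0_norm ?invr_ge0 ?(ltW M0) // nrm_sqr //.
  by rewrite ler_pdivrMl // mulr1 lerDl.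
have ys : y^*s = y by rewrite starZr starMr vs.
pose s := sqrt1B y; pose u := (Num.sqrt M)%:C%C *: s.
have us : u^*s = u by rewrite starZr sqrt1B_star.
have uu : u * u = M%:C%C *: (1 : A) - v * v.
  rewrite scaleAl scaleAr scalerA -rmorphM -expr2 sqr_sqrtr ?(ltW M0) //.
  rewrite sqrt1B_sqr // scalerBr scalerA -rmorphM divff ?gt_eqF //.
  by rewrite scale1r.
rewrite -uu nrm_sqr // -[leRHS]sqr_sqrtr ?(ltW M0) //.
rewrite ler_sqr ?nnegrE ?nrm_ge0 ?sqrtr_ge0 //.
apply: (@nrm_le_sqrD _ _ u v) => //.
- apply/commr_sym/commZ; apply: sqrt1B_comm => //.
  by apply: commZ; exact: commrM.
- by rewrite uu subrK sqr_sqrtr // ltW.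
Qed.

Lemma posn1 : posn 1.
Proof. by rewrite -[X in posn X]mulr1; apply: posn_sqr; exact: star1. Qed.

Lemma posn_sc r : 0 <= r -> posn (r%:C%C *: (1 : A)).
Proof. by move=> r0; apply: posnZ => //; exact: posn1. Qed.

(** If |M - x| <= M, then y = 1 - x / M is in the unit ball and x = M (1 - y). Taking M >= 1 allows
    the division. *)
Lemma posn_sqrt x : posn x -> exists v,
  [/\ v^*s = v, v * v = x & forall z, GRing.comm z x -> GRing.comm z v].
Proof.
move=> px; have [xs _] := px; have [N _ /(_ (Num.max 1 N))] := posn_bound px.
rewrite le_max lexx orbT => /(_ isT).
have : 0 < Num.max 1 N by rewrite lt_max ltr01.
move: (Num.max 1 N) => M M0 xM.
pose y := 1 - (M^-1)%:C%C *: x.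
have Mx : M%:C%C *: (1 - y) = x.
  rewrite /y subKr scalerA -rmorphM divff ?gt_eqF //.
  by rewrite scale1r.
have y1 : nrm y <= 1.
  rewrite -(@ler_pM2l _ M) // mulr1.
  rewrite -{1}[M]gtr0_norm // -nrmZr /y scalerBr scalerA -rmorphM.
  by rewrite divff ?gt_eqF // scale1r.
have ys : y^*s = y by rewrite starB star1 starZr xs.
exists ((Num.sqrt M)%:C%C *: sqrt1B y); split.
- by rewrite starZr sqrt1B_star.
- rewrite scaleAl scaleAr scalerA -rmorphM -expr2 sqr_sqrtr ?(ltW M0) //.
  by rewrite sqrt1B_sqr.
- move=> z zx; apply: commZ; apply: sqrt1B_comm => //.
  by apply: commrB; [exact: commr1|exact: commZ].
Qed.

(** Two uses of the commutation clause of [posn_sqrt] make the roots u and v commute, so x y = (u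
    v)^2. *)
Lemma posnM x y : GRing.comm x y -> posn x -> posn y -> posn (x * y).
Proof.
move=> xy /posn_sqrt[u [us xE uc]] /posn_sqrt[v [vs yE vc]].
have uv : GRing.comm u v.
  by apply: vc; apply: commr_sym; apply: uc; exact: commr_sym.
have -> : x * y = u * v * (u * v).
  by rewrite -xE -yE -!mulrA; congr (_ * _); rewrite !mulrA uv.
by apply: posn_sqr; rewrite starMr us vs.
Qed.

(** The product (M - x) (M + x) = M^2 - x^2 of commuting positive elements has a root v, and x^2 +
    v^2 = M^2 bounds x. *)
Lemma nrm_le_posn x M : 0 <= M -> x^*s = x ->
  posn (M%:C%C *: (1 : A) - x) -> posn (M%:C%C *: (1 : A) + x) -> nrm x <= M.
Proof.
move=> M0 xs pB pD.
have c z : GRing.comm z x -> GRing.comm z (M%:C%C *: (1 : A) + x).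
  by move=> zx; apply: commrD => //; apply/commZ/commr1.
have cx : GRing.comm (M%:C%C *: (1 : A) - x) (M%:C%C *: (1 : A) + x).
  by apply: c; apply/commr_sym/commrB => //; apply/commZ/commr1.
have [v [vs vE vc]] := posn_sqrt (posnM cx pB pD).
apply: (nrm_le_sqrD xs vs) => //.
  apply: vc; apply: commrM; last exact: c.
  by apply: commrB => //; apply/commZ/commr1.
rewrite addrC vE mulrBl !mulrDr !scaleAl !scaleAr !mul1r !mulr1.
by rewrite scalerA -rmorphM opprD addrA addrK subrK expr2.
Qed.

End Positivity.

(** * Contractivity and continuity of unital star-homomorphisms *)

Section Contractive.
Variables (R : realType) (A B : cstarAlgType R) (h : A -> B).
Hypothesis hh : unital_star_hom h.
Implicit Types (x y : A).

Lemma star_homD x y : h (x + y) = h x + h y.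
Proof. by case: hh => -[+ _ _ _] => /(_ 1 x y); rewrite !scale1r. Qed.

Lemma star_hom0 : h 0 = 0.
Proof. by apply: (addrI (h 0)); rewrite -star_homD !addr0. Qed.

Lemma star_homZ (c : R[i]) x : h (c *: x) = c *: h x.
Proof.
by case: hh => -[+ _ _ _] => /(_ c x 0); rewrite star_hom0 !addr0.
Qed.

Lemma star_homB x y : h (x - y) = h x - h y.
Proof. by rewrite star_homD -scaleN1r star_homZ scaleN1r. Qed.

Lemma star_homM x y : h (x * y) = h x * h y.
Proof. by case: hh => -[_ + _ _]; apply. Qed.

Lemma star_homS x : h x^*s = (h x)^*s.
Proof. by case: hh => -[_ _ + _]; apply. Qed.

Lemma star_hom1 : h 1 = 1.
Proof. by case: hh. Qed.

(** For y in the unit ball and z = y^* y, the relation z^2 + s^2 = 1 with s = [sqrt1B (z * z)] is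
    preserved by h, as are self-adjointness and commutation. These bound h z by 1, and |h y|^2 = |h
    z|. *)
Lemma star_hom_contractive x : nrm (h x) <= nrm x.
Proof.
have unit_ball y : nrm y <= 1 -> nrm (h y) <= 1.
  move=> y1; pose z := y^*s * y.
  have zs : z^*s = z by rewrite starMr starK.
  have z1 : nrm z <= 1 by rewrite nrm_starM; have := nrm_ge0 y; nra.
  have zz1 : nrm (z * z) <= 1 by rewrite nrm_sqr //; have := nrm_ge0 z; nra.
  have : nrm (h z) <= 1.
    apply: (@nrm_le_sqrD _ _ _ (h (sqrt1B (z * z)))) => //.
    - by rewrite -star_homS zs.
    - by rewrite -star_homS sqrt1B_star // starMr zs.
    - rewrite /GRing.comm -!star_homM; congr h.
      by apply: sqrt1B_comm => //; exact: commrM.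
    - by rewrite -!star_homM sqrt1B_sqr // -star_homD addrC subrK star_hom1
        expr1n scale1r.
  by rewrite star_homM star_homS nrm_starM; have := nrm_ge0 (h y); nra.
have := nrm_ge0 x; rewrite le_eqVlt => /predU1P[/esym x0|x0].
  by rewrite (nrm_eq0 x0) star_hom0 !nrm0.
have := unit_ball ((nrm x)^-1%:C%C *: x).
rewrite star_homZ !nrmZr gtr0_norm ?invr_gt0 // mulVf ?gt_eqF //.
by rewrite ler_pdivrMl // mulr1; apply.
Qed.

Lemma star_hom_cvg (u : nat -> A) x :
  u @ \oo --> x -> (h \o u) @ \oo --> h x.
Proof.
move=> /cvg_nrm ux; apply/cvg_nrm => e /ux[N HN]; exists N => n /HN.
by rewrite /= -star_homB; apply/le_trans/star_hom_contractive.
Qed.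

Lemma star_hom_sqrt1B x : nrm x <= 1 -> h (sqrt1B x) = sqrt1B (h x).
Proof.
move=> x1; rewrite /sqrt1B star_homB star_hom1; congr (_ - _).
have hx1 : nrm (h x) <= 1 := le_trans (star_hom_contractive x) x1.
apply: (cvgA_unique (star_hom_cvg (sqrt_iter_cvg x1))).
have hw n : h (sqrt_iter x n) = sqrt_iter (h x) n.
  elim: n => [|n IH] /=; first exact: star_hom0.
  by rewrite star_homZ star_homD star_homM IH.
by rewrite (_ : h \o _ = sqrt_iter (h x)); [exact: sqrt_iter_cvg|exact/funext].
Qed.

End Contractive.

Section ContractiveSquares.
Variables (R : realType) (A : cstarAlgType R).
Implicit Types (x : A).

Lemma nrm_le1_posn x : x^*s = x -> posn (1 - x * x) -> nrm x <= 1.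
Proof.
move=> xs /posn_sqrt[v [vs vE vc]].
apply: (nrm_le_sqrD xs vs) => //.
  by apply: vc; apply: commrB; [exact: commr1|exact: commrM].
by rewrite vE addrC subrK expr1n scale1r.
Qed.

(** The element 1 - g_i^2 is the sum of the other squares, hence positive. *)
Lemma nrm_le1_sum_sqr m (g : 'I_m -> A) : (forall i, (g i)^*s = g i) ->
  \sum_i g i * g i = 1 -> forall i, nrm (g i) <= 1.
Proof.
move=> gs g1 i; apply: nrm_le1_posn => //.
rewrite -g1 (bigD1 i) //= [X in X - _]addrC addrK.
by elim/big_ind: _ => [||j _]; [exact: posn0|exact: posnD|exact: posn_sqr].
Qed.

End ContractiveSquares.

(** * Bernstein operators *)

Section Bernstein.
Variables (R : realType) (A : cstarAlgType R).
Implicit Types (a x y z : A) (c : R[i]) (phi psi : nat -> A).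

(* [bern a n phi] is the sum of [bin n k * a ^ k * (1 - a) ^ (n - k) * phi k]
   over [k <= n], that is, the expectation of [phi] under a binomial law of
   parameter [a]; the recursion conditions on the first trial. *)
Fixpoint bern a n phi : A :=
  if n is n'.+1 then
    a * bern a n' (fun k => phi k.+1) + (1 - a) * bern a n' phi
  else phi 0%N.

Lemma eq_bern a n phi psi :
  (forall k, (k <= n)%N -> phi k = psi k) -> bern a n phi = bern a n psi.
Proof.
elim: n phi psi => [|n IH] phi psi pp /=; first exact: pp.
by congr (_ * _ + _ * _); apply: IH => k kn; apply: pp => //; exact: leqW.
Qed.

Lemma bernD a n phi psi :
  bern a n (fun k => phi k + psi k) = bern a n phi + bern a n psi.
Proof.
by elim: n phi psi => //= n IH phi psi; rewrite !IH !mulrDr addrACA.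
Qed.

Lemma bernZ a n c phi : bern a n (fun k => c *: phi k) = c *: bern a n phi.
Proof.
by elim: n phi => //= n IH phi; rewrite !IH !scaleAr scalerDr.
Qed.

Lemma bernN a n phi : bern a n (fun k => - phi k) = - bern a n phi.
Proof. by elim: n phi => //= n IH phi; rewrite !IH !mulrN opprD. Qed.

Lemma bernB a n phi psi :
  bern a n (fun k => phi k - psi k) = bern a n phi - bern a n psi.
Proof. by rewrite bernD bernN. Qed.

Lemma bernMr a n phi z : bern a n (fun k => phi k * z) = bern a n phi * z.
Proof.
by elim: n phi => //= n IH phi; rewrite !IH [RHS]mulrDl !mulrA.
Qed.

Lemma bern_cst a n z : bern a n (fun=> z) = z.
Proof. by elim: n => //= n ->; rewrite -mulrDl [a + _]addrC subrK mul1r. Qed.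

Lemma bern_comm a n phi z : GRing.comm z a ->
  (forall k, (k <= n)%N -> GRing.comm z (phi k)) -> GRing.comm z (bern a n phi).
Proof.
move=> za; elim: n phi => [|n IH] phi zp /=; first exact: zp.
apply: commrD; apply: commrM => //; first by apply: IH => k kn; apply: zp.
  by apply: commrB => //; exact: commr1.
by apply: IH => k kn; apply/zp/leqW.
Qed.

(** The star reverses each product; commutation of [a] with the values restores the order. *)
Lemma bern_star a n phi : a^*s = a ->
  (forall k, (k <= n)%N -> GRing.comm a (phi k)) ->
  (bern a n phi)^*s = bern a n (fun k => (phi k)^*s).
Proof.
move=> aS; elim: n phi => //= n IH phi ap.
have f1 : GRing.comm a (bern a n (fun k => phi k.+1)).
  by apply: bern_comm => // k kn; exact: ap.
have f2 : GRing.comm (1 - a) (bern a n phi).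
  apply: bern_comm => [|k kn]; apply/commr_sym/commrB; try exact: commr1.
    by [].
  by apply/commr_sym/ap/leqW.
rewrite f1 f2 starD !starMr starB star1 aS !IH // => k kn; apply: ap => //.
exact: leqW.
Qed.

Lemma bern_posn a n phi : posn a -> posn (1 - a) ->
  (forall k, (k <= n)%N -> GRing.comm a (phi k) /\ posn (phi k)) ->
  posn (bern a n phi).
Proof.
move=> pa p1a; elim: n phi => [|n IH] phi pp /=; first by case: (pp 0%N).
have c psi : (forall k, (k <= n)%N -> GRing.comm a (psi k)) ->
    GRing.comm a (bern a n psi) by exact: bern_comm.
apply: posnD; apply: posnM => //.
- by apply: c => k kn; case: (pp k.+1).
- by apply: IH => k kn; exact: pp.
- apply/commr_sym/commrB; first exact: commr1.
  by apply/commr_sym/c => k /leqW kn; case: (pp k).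
- by apply: IH => k /leqW kn; exact: pp.
Qed.

Lemma bern_mean a n : bern a n (fun k => k%:R) = a *+ n.
Proof.
elim: n => //= n IH.
under [X in a * X]eq_bern => k _ do rewrite -natr1.
rewrite bernD bern_cst IH mulrDr mulr1 addrAC -mulrDl [a + _]addrC subrK mul1r.
by rewrite mulrSr.
Qed.

(** Induction through (k + 1)^2 = k^2 + 2 k + 1 and the mean. The truncated predecessor at n = 0 is
    harmless, being multiplied by 0. *)
Lemma bern_second_moment a n :
  bern a n (fun k => (k * k)%:R) = (a * a) *+ (n * n.-1) + a *+ n.
Proof.
elim: n => [|n IH] /=; first by rewrite mulr0n addr0.
under [X in a * X]eq_bern => k _.
  rewrite (_ : (k.+1 * k.+1 = k * k + (k * 2 + 1))%N); last by ring.
  rewrite natrD [X in _ + X]natrD [(k * 2)%:R]natrM; over.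
rewrite !bernD bern_cst bernMr bern_mean IH.
rewrite mulrDr addrAC -mulrDl [a + _]addrC subrK mul1r addrC.
rewrite mulrDr mulr1 mulrA mulr_natr mulrnAr -mulrnA addrACA -mulrnDr -mulrS.
by congr (_ *+ _ + _); case: (n) => // k; rewrite /=; ring.
Qed.

Lemma natr_scale k : (k%:R : R)%:C%C *: (1 : A) = k%:R.
Proof. by rewrite rmorph_nat scaler_nat. Qed.

(** The frequency of successes, which is also the Bernstein node. *)
Definition bern_pt n k : R := k%:R / n%:R.

Lemma bern_pt_mean a n : (0 < n)%N ->
  bern a n (fun k => (bern_pt n k)%:C%C *: (1 : A)) = a.
Proof.
move=> n0.
under eq_bern => k _ do rewrite /bern_pt mulrC rmorphM -scalerA natr_scale.
rewrite bernZ bern_mean -(scaler_nat n a) scalerA.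
rewrite -(rmorph_nat (real_complex R)) -rmorphM mulVf ?scale1r //.
by rewrite pnatr_eq0 -lt0n.
Qed.

Lemma bern_pt_second_moment a n : (0 < n)%N ->
  bern a n (fun k => (bern_pt n k ^+ 2)%:C%C *: (1 : A)) =
  a * a + (n%:R^-1)%:C%C *: (a - a * a).
Proof.
case: n => // n _; set N : R := n.+1%:R.
have N0 : N != 0 by rewrite pnatr_eq0.
under eq_bern => k _.
  rewrite /bern_pt exprMn mulrC [k%:R ^+ 2]expr2 -natrM rmorphM -scalerA.
  rewrite natr_scale; over.
rewrite bernZ bern_second_moment /= -!(scaler_nat _ a) -!(scaler_nat _ (a * a)).
rewrite -!(rmorph_nat (real_complex R)) scalerDr !scalerA -!rmorphM.
have -> : N^-1 ^+ 2 * n.+1%:R = N^-1 by rewrite -/N; field.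
have -> : N^-1 ^+ 2 * (n.+1 * n)%:R = 1 - N^-1.
  by rewrite natrM (_ : n%:R = N - 1) -/N; [field|rewrite /N -natr1 addrK].
by rewrite rmorphB scalerBl scalerBr scale1r -addrA [in LHS](addrC (- _)).
Qed.

(* The mean square distance of two independent binomial frequencies. *)
Lemma bern2_variance a n m : (0 < n)%N -> (0 < m)%N ->
  bern a n (fun k => bern a m (fun l =>
    ((bern_pt n k - bern_pt m l) ^+ 2)%:C%C *: (1 : A))) =
  (n%:R^-1 + m%:R^-1)%:C%C *: (a - a * a).
Proof.
move=> n0 m0.
(* The expanded square involves only first and second moments; the cross term contributes -2 a^2. *)
have sqB (p r : R) : ((p - r) ^+ 2)%:C%C *: (1 : A) = (p ^+ 2)%:C%C *: (1 : A) -
    (p *+ 2)%:C%C *: (r%:C%C *: (1 : A)) + (r ^+ 2)%:C%C *: (1 : A).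
  rewrite scalerA -rmorphM -scalerBl -rmorphB -scalerDl -rmorphD.
  by congr (_%:C%C *: _); ring.
under eq_bern => k _.
  under eq_bern => l _ do rewrite sqB.
  rewrite bernD bernB bern_cst bernZ bern_pt_mean // bern_pt_second_moment //.
  over.
rewrite bernD bernB bern_cst bern_pt_second_moment //.
under [X in _ - X]eq_bern => k _.
  rewrite rmorphMn -scalerMnl scalerMnr -[X in _ *: X]mul1r -scaleAl; over.
rewrite bernMr bern_pt_mean // mulrnAr mulr2n rmorphD scalerDl.
move: (a * a) (_ *: _) (_ *: _) => b c d.
by rewrite [b + d]addrC opprD [_ + (- b - b)]addrA addrK addrA subrK.
Qed.

(** The expectations of e + C (s - t)^2 - c and e + C (s - t)^2 + c are positive, and the variance
    term C (1/n + 1/m) (a - a^2) is at most C (1/n + 1/m); [nrm_le_posn] concludes. *)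
Lemma nrm_bern2_le a n m (c : nat -> nat -> R) e C :
  posn a -> posn (1 - a) -> (0 < n)%N -> (0 < m)%N -> 0 <= e -> 0 <= C ->
  (forall k l, (k <= n)%N -> (l <= m)%N ->
    `|c k l| <= e + C * (bern_pt n k - bern_pt m l) ^+ 2) ->
  nrm (bern a n (fun k => bern a m (fun l => (c k l)%:C%C *: (1 : A)))) <=
  e + C * (n%:R^-1 + m%:R^-1).
Proof.
move=> pa p1a n0 m0 e0 C0 cle.
pose E (c : nat -> nat -> R) :=
  bern a n (fun k => bern a m (fun l => (c k l)%:C%C *: (1 : A))).
have ED f1 f2 : E (fun k l => f1 k l + f2 k l) = E f1 + E f2.
  rewrite /E -bernD; apply: eq_bern => k _; rewrite -bernD.
  by apply: eq_bern => l _; rewrite rmorphD scalerDl.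
have EN f1 : E (fun k l => - f1 k l) = - E f1.
  rewrite /E -bernN; apply: eq_bern => k _; rewrite -bernN.
  by apply: eq_bern => l _; rewrite rmorphN scaleNr.
have EZ r f1 : E (fun k l => r * f1 k l) = r%:C%C *: E f1.
  rewrite /E -bernZ; apply: eq_bern => k _; rewrite -bernZ.
  by apply: eq_bern => l _; rewrite rmorphM scalerA.
have Ecst r : E (fun _ _ => r) = r%:C%C *: (1 : A) by rewrite /E !bern_cst.
have comm_sc r : GRing.comm a (r%:C%C *: (1 : A)).
  by apply: commZ; exact: commr1.
have Epos f1 : (forall k l, (k <= n)%N -> (l <= m)%N -> 0 <= f1 k l) ->
    posn (E f1).
  move=> f10; apply: bern_posn => // k kn; split; first exact: bern_comm.
  by apply: bern_posn => // l lm; split=> //; apply/posn_sc/f10.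
have Estar f1 : (E f1)^*s = E f1.
  rewrite /E bern_star; last by move=> *; exact: bern_comm.
    apply: eq_bern => k _; rewrite bern_star //; last by case: pa.
    by apply: eq_bern => l _; rewrite starZr star1.
  by case: pa.
pose v k l := (bern_pt n k - bern_pt m l) ^+ 2.
(* This is (1 - a) + a^2, a sum of positive elements. *)
have p1aa : posn (1 - (a - a * a)).
  by rewrite opprB addrCA addrC; apply: posnD => //; apply: posn_sqr; case: pa.
set s := n%:R^-1 + m%:R^-1.
have s0 : 0 <= s by rewrite addr_ge0 ?invr_ge0 ?ler0n.
have ptE f1 : (e + C * s)%:C%C *: (1 : A) + E f1 =
    E (fun k l => e + C * v k l + f1 k l) + (C * s)%:C%C *: (1 - (a - a * a)).
  rewrite !ED EZ Ecst [E v]bern2_variance // scalerA -rmorphM rmorphD scalerDl.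
  by rewrite [RHS]addrAC -[X in _ = X + _]addrA -scalerDr subrKC.
apply: nrm_le_posn => //.
- by rewrite addr_ge0 // mulr_ge0.
- exact: Estar.
- rewrite -[bern a n _]/(E c) -EN ptE; apply: posnD; last first.
    by apply: posnZ => //; rewrite mulr_ge0.
  apply: Epos => k l kn lm; have := cle k l kn lm.
  by rewrite ler_norml => /andP[_]; rewrite subr_ge0.
- rewrite -[bern a n _]/(E c) ptE; apply: posnD; last first.
    by apply: posnZ => //; rewrite mulr_ge0.
  apply: Epos => k l kn lm; have := cle k l kn lm.
  by rewrite ler_norml => /andP[+ _]; rewrite -subr_ge0 opprK addrC.
Qed.

End Bernstein.

Lemma bern_morph (R : realType) (A B : cstarAlgType R) (h : A -> B) a n phi :
  unital_star_hom h -> h (bern a n phi) = bern (h a) n (h \o phi).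
Proof.
move=> hh; elim: n phi => //= n IH phi.
by rewrite (star_homD hh) !(star_homM hh) (star_homB hh) (star_hom1 hh) !IH.
Qed.

(** * Continuous functional calculus *)

Section Modulus.
Variable R : realType.
Implicit Types (f : C0_itv R) (p e : R).

Lemma C0_local_continuity f p e : 0 <= p <= 1 -> 0 < e -> exists2 d, 0 < d &
  forall u, 0 <= u <= 1 -> `|u - p| < d -> `|f u - f p| <= e%:C%C.
Proof.
move=> p01 e0; have [cf _] := C0P f.
have /(_ p) :=
  (@subspace_continuousP R `[0%R, 1%R]%classic R[i]^o (f : R -> R[i]^o)).1 cf.
rewrite /= in_itv /= => /(_ p01).
move/(@cvgrPdistC_le R[i] R[i]^o _ _ _ _ _).1 => /(_ e%:C%C).
rewrite ltcR => /(_ e0) /nbhs_ballP[d d0 Hd]; exists d => // u u01 up.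
apply: Hd; last by rewrite /= in_itv.
by rewrite -ball_normE /= distrC.
Qed.

(** Uniform continuity and boundedness in one estimate. If every C = n fails, the offending pairs
    cluster at some (p, p') of the compact unit square. *)
Lemma C0_modulus f e : 0 < e -> exists2 C, 0 <= C & forall s t : R,
  0 <= s <= 1 -> 0 <= t <= 1 ->
  `|f s - f t| <= (e + C * (s - t) ^+ 2)%:C%C.
Proof.
move=> e0; apply: contrapT => nC.
have /choice[st stP] : forall n : nat, exists st : R * R,
    [/\ 0 <= st.1 <= 1, 0 <= st.2 <= 1
      & (e + n%:R * (st.1 - st.2) ^+ 2)%:C%C < `|f st.1 - f st.2| ].
  move=> n; apply: contrapT => nst; apply: nC; exists n%:R => // s t s01 t01.
  rewrite real_leNgt ?normr_real ?complex_real //.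
  by apply/negP => st; apply: nst; exists (s, t).
have /= := compact_setX (@segment_compact R 0 1) (@segment_compact R 0 1).
move=> /(_ (st @ \oo) _)[].
  by exists 0%N => // n _ /=; rewrite !in_itv /=; have [] := stP n.
move=> [p p'] [] [] /=; rewrite !in_itv /= => p01 p'01 clp.
have near_p d1 d2 N : 0 < d1 -> 0 < d2 -> exists n, [/\ (N <= n)%N,
    `|(st n).1 - p| < d1 & `|(st n).2 - p'| < d2].
  move=> d10 d20.
  have [||x [[n Nn <-] [/= up up']]] :=
      clp [set st n | n in [set n | (N <= n)%N]] (ball p d1 `*` ball p' d2);
    last by exists n; split=> //; rewrite distrC.
    by exists N => // n Nn; exists n.
  by exists (ball p d1, ball p' d2) => //; split; exact: nbhsx_ballx.
have fE x y : `|f x - f y| = (complex.Re `|f x - f y|)%:C%C.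
  by rewrite RRe_real // normr_real.
(* On the diagonal, continuity at p already gives |f s - f t| <= e. *)
have [pp'|pp'] := eqVneq p p'.
  have [d d0 Hd] := C0_local_continuity f p01 (divr_gt0 e0 (ltr0n R 2)).
  have [n [_ sp tp]] := near_p d d 0%N d0 d0.
  have [s01 t01] := stP n; apply/negP.
  rewrite -real_leNgt ?normr_real ?complex_real //.
  rewrite -pp' in tp.
  apply: le_trans (ler_distD (f p) _ _) _.
  apply: (le_trans (lerD (Hd _ s01 sp) _)).
    by rewrite distrC; exact: Hd t01 tp.
  by rewrite -rmorphD lecR -splitr lerDl mulr_ge0 ?sqr_ge0.
have D0 : 0 < `|p - p'| by rewrite normr_gt0 subr_eq0.
set D := `|p - p'| in D0.
have [d1 d10 Hd1] := C0_local_continuity f p01 ltr01.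
have [d2 d20 Hd2] := C0_local_continuity f p'01 ltr01.
pose v : R := complex.Re `|f p - f p'|.
have D4 : 0 < D / 4 by rewrite divr_gt0.
(* Within D / 4 of p and p' one has |s - t| >= D / 2, while |f s - f t| <= v + 2; for n >= N, n (D /
   2)^2 is at least v + 2. *)
pose N := Num.bound (4 * (v + 2) / D ^+ 2).
have [||n [Nn]] := near_p (Num.min d1 (D / 4)) (Num.min d2 (D / 4)) N.
- by rewrite lt_min d10.
- by rewrite lt_min d20.
rewrite !lt_min => /andP[sp1 sp2] /andP[tp1 tp2].
have [s01 t01] := stP n; apply/negP.
rewrite -real_leNgt ?normr_real ?complex_real //.
apply: le_trans (ler_distD (f p) _ _) _.
apply: (le_trans (lerD (Hd1 _ s01 sp1) (ler_distD (f p') _ _))).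
rewrite (distrC (f p')) fE -/v.
apply: (le_trans (lerD (lexx _) (lerD (lexx _) (Hd2 _ t01 tp1)))).
rewrite -!rmorphD lecR.
have nD : 4 * (v + 2) / D ^+ 2 <= n%:R.
  have v0 : 0 <= 4 * (v + 2) / D ^+ 2.
    rewrite mulr_ge0 ?invr_ge0 ?sqr_ge0 // mulr_ge0 // addr_ge0 //.
    by rewrite -(lecR (R := R)) /v -fE; exact: normr_ge0.
  by apply: le_trans (ltW (archi_boundP v0)) _; rewrite ler_nat.
have D2 : (D / 2) ^+ 2 <= ((st n).1 - (st n).2) ^+ 2.
  rewrite -[leRHS]real_normK ?num_real //.
  rewrite ler_sqr ?nnegrE ?divr_ge0 ?normr_ge0 //.
  have := ler_distD (st n).1 p p'; have := ler_distD (st n).2 (st n).1 p'.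
  by rewrite -/D (distrC p); lra.
have : v + 2 <= n%:R * (D / 2) ^+ 2.
  by move: nD; rewrite ler_pdivrMr ?exprn_gt0 // expr_div_n; lra.
have := ler_wpM2l (ler0n R n) D2; lra.
Qed.

(** The modulus for e = 1 compares each value with that at 0, where f vanishes. *)
Lemma C0_bounded f : exists2 B, 0 <= B &
  forall t, 0 <= t <= 1 -> `|f t| <= B%:C%C.
Proof.
have [C C0 fC] := C0_modulus f ltr01; exists (1 + C); first by rewrite addr_ge0.
move=> t /[dup] t01 /andP[t0 t1]; have [_ f0] := C0P f.
have := fC t 0 t01; rewrite lexx ler01 => /(_ isT).
rewrite (f0 0) ?ltxx // !subr0 => /le_trans; apply; rewrite lecR lerD2l.
by rewrite ler_piMr // expr_le1.
Qed.

End Modulus.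

Section FunctionalCalculus.
Variables (R : realType) (A : cstarAlgType R).
Implicit Types (f g : C0_itv R) (e C : R).

Lemma bern_pt_itv n k : (0 < n)%N -> (k <= n)%N -> 0 <= bern_pt R n k <= 1.
Proof.
move=> n0 kn; rewrite /bern_pt divr_ge0 ?ler0n //=.
by rewrite ler_pdivrMr ?ltr0n // mul1r ler_nat.
Qed.

Lemma div_succ_small C e : 0 < e ->
  exists N, forall n, (N <= n)%N -> C * n.+1%:R^-1 <= e.
Proof.
move=> e0; exists (Num.bound `|C / e|) => n Nn.
rewrite ler_pdivrMr ?ltr0n // mulrC -ler_pdivrMr //.
apply: le_trans (ler_norm _) _.
apply: le_trans (ltW (archi_boundP (normr_ge0 (C / e)))) _.
by rewrite ler_nat leqW.
Qed.

Lemma normc_ge_Im (c : R[i]) : `|complex.Im c|%:C%C <= `|c|.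
Proof.
by rewrite normc_def lecR -sqrtr_sqr ler_wsqrtr // lerDr sqr_ge0.
Qed.

(** Real and imaginary parts are bounded separately, whence the factor 2. *)
Lemma nrm_bern2C_le (a : A) n m (c : nat -> nat -> R[i]) e C :
  posn a -> posn (1 - a) -> (0 < n)%N -> (0 < m)%N -> 0 <= e -> 0 <= C ->
  (forall k l, (k <= n)%N -> (l <= m)%N ->
    `|c k l| <= (e + C * (bern_pt R n k - bern_pt R m l) ^+ 2)%:C%C) ->
  nrm (bern a n (fun k => bern a m (fun l => c k l *: (1 : A)))) <=
  2 * (e + C * (n%:R^-1 + m%:R^-1)).
Proof.
move=> pa p1a n0 m0 e0 C0 cle.
have -> : bern a n (fun k => bern a m (fun l => c k l *: (1 : A))) =
  bern a n (fun k => bern a m (fun l =>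
    (complex.Re (c k l))%:C%C *: (1 : A))) +
  'i%C *: bern a n (fun k => bern a m (fun l =>
    (complex.Im (c k l))%:C%C *: (1 : A))).
  rewrite -bernZ -bernD; apply: eq_bern => k _.
  rewrite -bernZ -bernD; apply: eq_bern => l _.
  by rewrite scalerA -scalerDl -complexE.
apply: le_trans (nrmD _ _) _; rewrite nrmZi mulr_natl mulr2n.
apply: lerD; apply: nrm_bern2_le => // k l kn lm; rewrite -(lecR (R := R)).
  by apply: le_trans (cle k l kn lm); exact: normc_ge_Re.
by apply: le_trans (cle k l kn lm); exact: normc_ge_Im.
Qed.

(** The Bernstein polynomial of degree n + 1 at [a]; the shift avoids nodes with denominator 0. *)
Definition bernC0 (a : A) f n : A :=
  bern a n.+1 (fun k => f (bern_pt R n.+1 k) *: (1 : A)).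

Definition fcalc (a : A) f : A := limn (bernC0 a f).

Variable a : A.
Hypotheses (pa : posn a) (p1a : posn (1 - a)).

Lemma bernC0_cvg f : bernC0 a f @ \oo --> fcalc a f.
Proof.
suff : cvgn (bernC0 a f) by [].
apply: nrm_cauchy_cvg => e e0.
(* The final bound is 2 (e/8 + C/(m+1) + C/(n+1)), each summand being at most e/8. *)
have e8 : 0 < e / 8 by rewrite divr_gt0.
have [C C0 fC] := C0_modulus f e8.
have [N HN] := div_succ_small C e8.
exists N => m n Nm Nn.
(* As the weights sum to 1, the difference is a single double expectation. *)
have -> : bernC0 a f m - bernC0 a f n = bern a m.+1 (fun k => bern a n.+1
    (fun l => (f (bern_pt R m.+1 k) - f (bern_pt R n.+1 l)) *: (1 : A))).
  rewrite -[X in _ - X](bern_cst a m.+1) -bernB; apply: eq_bern => k _.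
  rewrite -[X in X - _](bern_cst a n.+1) -bernB; apply: eq_bern => l _.
  by rewrite scalerBl.
have fmn k l : (k <= m.+1)%N -> (l <= n.+1)%N ->
    `|f (bern_pt R m.+1 k) - f (bern_pt R n.+1 l)| <=
    (e / 8 + C * (bern_pt R m.+1 k - bern_pt R n.+1 l) ^+ 2)%:C%C.
  by move=> km ln; apply: fC; exact: bern_pt_itv.
apply: le_trans (nrm_bern2C_le pa p1a _ _ (ltW e8) C0 fmn) _ => //.
have := HN m Nm; have := HN n Nn; rewrite !mulrDr.
by move: (C / _) (C / _) => x y; lra.
Qed.

Lemma fcalc_eq f (x : A) : bernC0 a f @ \oo --> x -> fcalc a f = x.
Proof. exact: (cvgA_unique (@bernC0_cvg f)). Qed.

Lemma fcalc_linear : linear (fcalc a).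
Proof.
move=> c f g; apply: fcalc_eq.
rewrite (_ : bernC0 a _ = (fun n => c *: bernC0 a f n + bernC0 a g n)).
  by apply: cvgD; [apply: cvgZl_tmp|]; exact: bernC0_cvg.
apply/funext => n; rewrite /bernC0 -bernZ -bernD; apply: eq_bern => k _.
by rewrite scalerA -scalerDl.
Qed.

Lemma fcalc_star f : fcalc a f^*s = (fcalc a f)^*s.
Proof.
apply: fcalc_eq.
rewrite (_ : bernC0 a _ = (fun n => (bernC0 a f n)^*s)).
  by apply: cvg_star; exact: bernC0_cvg.
apply/funext => n; rewrite /bernC0 bern_star; last first.
- by move=> k _; apply: commZ; exact: commr1.
- by case: pa.
by apply: eq_bern => k _; rewrite starZ star1.
Qed.

(** The multiplicativity defect of the Bernstein polynomials is the double expectation of f(s) (g(s)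
    - g(t)), controlled by a bound on f and the modulus of g. *)
Lemma fcalcM f g : fcalc a (f ** g) = fcalc a f * fcalc a g.
Proof.
apply: fcalc_eq.
rewrite (_ : bernC0 a _ = (fun n => (bernC0 a (f ** g) n -
    bernC0 a f n * bernC0 a g n) + bernC0 a f n * bernC0 a g n)); last first.
  by apply/funext => n; rewrite subrK.
rewrite -[X in _ --> X]add0r; apply: cvgD; last first.
  by apply: cvg_mulA; exact: bernC0_cvg.
apply/cvg_nrm => e e0; rewrite /=.
have [B B0 fB] := C0_bounded f.
(* Dividing by B + 1 covers B = 0 and still gives B d <= e/8. *)
pose d := e / 8 / (B + 1).
have d0 : 0 < d by rewrite !divr_gt0 // ltr_wpDl.
have Bd : B * d <= e / 8.
  rewrite /d mulrCA ler_piMr ?divr_ge0 ?(ltW e0) //.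
  by rewrite ler_pdivrMr ?ltr_wpDl // mul1r lerDl.
have [C C0 gC] := C0_modulus g d0.
have [N HN] := @div_succ_small (B * C) (e / 8) (divr_gt0 e0 (ltr0n R 8)).
exists N => n /HN Nn; rewrite subr0.
have -> : bernC0 a (f ** g) n - bernC0 a f n * bernC0 a g n =
    bern a n.+1 (fun k => bern a n.+1 (fun l => (f (bern_pt R n.+1 k) *
    (g (bern_pt R n.+1 k) - g (bern_pt R n.+1 l))) *: (1 : A))).
  rewrite -bernMr -bernB; apply: eq_bern => k _.
  rewrite scaleAl mul1r -bernZ -[X in X - _](bern_cst a n.+1) -bernB.
  by apply: eq_bern => l _; rewrite scalerA -scalerBl mulrBr.
have fgn k l : (k <= n.+1)%N -> (l <= n.+1)%N ->
    `|f (bern_pt R n.+1 k) * (g (bern_pt R n.+1 k) - g (bern_pt R n.+1 l))| <=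
    (B * d + B * C * (bern_pt R n.+1 k - bern_pt R n.+1 l) ^+ 2)%:C%C.
  move=> kn ln; rewrite normrM -mulrA -mulrDr rmorphM.
  by apply: ler_pM => //; [apply: fB|apply: gC]; exact: bern_pt_itv.
apply: le_trans (nrm_bern2C_le pa p1a _ _ _ _ fgn) _ => //.
- by rewrite mulr_ge0 // ltW.
- by rewrite mulr_ge0.
by move: Nn; rewrite !mulrDr; move: (B * C / _) => x; lra.
Qed.

Lemma fcalc_star_hom : star_hom (fcalc a).
Proof. by split; [exact: fcalc_linear|exact: fcalcM|exact: fcalc_star]. Qed.

Lemma fcalc_id : fcalc a (C0_id R) = a.
Proof.
apply: fcalc_eq; rewrite (_ : bernC0 a _ = cst a); first exact: cvg_cst.
(* No, placeholder.

   This entry is void and is replaced by the next one. *)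
apply/funext => n; rewrite /cst -[RHS](@bern_pt_mean _ _ _ n.+1) //.
apply: eq_bern => k kn; have /andP[] := bern_pt_itv (ltn0Sn n) kn.
(* The node k = 0 is 0, which agrees with the default value of [C0_id] off (0,1]. *)
rewrite /= le_eqVlt => /predU1P[<-|->] ->; last by [].
by rewrite ltxx.
Qed.

End FunctionalCalculus.

(** * Orthogonality and naturality of the functional calculus *)

Section Orthogonality.
Variables (R : realType) (A : cstarAlgType R).
Implicit Types (a b : A) (phi psi : nat -> R[i]).

(** The weights with k >= 1 all contain a factor [a], and the weight at k = 0 is killed. *)
Lemma bern_factor_r a n phi : phi 0%N = 0 ->
  exists x, bern a n (fun k => phi k *: (1 : A)) = x * a.
Proof.
move=> p0; elim: n => [|n [x IH]] /=.
  by exists 0; rewrite p0 scale0r mul0r.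
exists (bern a n (fun k => phi k.+1 *: (1 : A)) + (1 - a) * x).
rewrite IH [RHS]mulrDl mulrA; congr (_ + _); apply: bern_comm => // k _.
by apply: commZ; exact: commr1.
Qed.

Lemma bern_factor_l a n phi : phi 0%N = 0 ->
  exists x, bern a n (fun k => phi k *: (1 : A)) = a * x.
Proof.
move=> p0; elim: n => [|n [x IH]] /=.
  by exists 0; rewrite p0 scale0r mulr0.
exists (bern a n (fun k => phi k.+1 *: (1 : A)) + (1 - a) * x).
rewrite IH [RHS]mulrDr !mulrA; congr (_ + _ * _).
by rewrite mulrBl mulrBr mul1r mulr1.
Qed.

(** The approximants factor as x a and b y, so their product contains a b = 0. *)
Lemma fcalc_orthogonal a b (f g : C0_itv R) :
  posn a -> posn (1 - a) -> posn b -> posn (1 - b) -> a * b = 0 ->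
  fcalc a f * fcalc b g = 0.
Proof.
move=> pa p1a pb p1b ab.
have C00 (k : C0_itv R) n : k (bern_pt R n 0) = 0.
  by have [_ ->] := C0P k; rewrite // /bern_pt mul0r ltxx.
have fg0 := cvg_mulA (@bernC0_cvg _ _ _ pa p1a f) (@bernC0_cvg _ _ _ pb p1b g).
apply: (cvgA_unique fg0); rewrite (_ : (fun=> _) = cst 0); first exact: cvg_cst.
apply/funext => n.
have [x xE] := bern_factor_r a n.+1 (phi := f \o bern_pt R n.+1) (C00 f n.+1).
have [y yE] := bern_factor_l b n.+1 (phi := g \o bern_pt R n.+1) (C00 g n.+1).
by rewrite /bernC0 xE yE mulrA -(mulrA x) ab mulr0 mul0r.
Qed.

Lemma fcalc_morph (B : cstarAlgType R) (h : A -> B) a (f : C0_itv R) :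
  unital_star_hom h -> posn a -> posn (1 - a) -> posn (h a) -> posn (1 - h a) ->
  h (fcalc a f) = fcalc (h a) f.
Proof.
move=> hh pa p1a pha p1ha; apply/esym/fcalc_eq => //.
rewrite (_ : bernC0 (h a) f = h \o bernC0 a f).
  by apply: star_hom_cvg => //; exact: bernC0_cvg.
apply/funext => n; rewrite /= /bernC0 bern_morph //; apply: eq_bern => k _ /=.
by rewrite (star_homZ hh) (star_hom1 hh).
Qed.

End Orthogonality.

(** * Odd elements and the local-triviality dimension *)

Section OddElement.
Variables (R : realType) (A : cstarAlgType R) (alpha : 'Z_2 -> A -> A).
Hypothesis act : cstar_action alpha.

Lemma equivariant_hom_of_odd (g : A) :
  g^*s = g -> alpha 1%R g = - g -> nrm g <= 1 ->
  exists rho, equivariant_hom alpha rho /\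
    rho (tensor (C0_id R) (fun=> 1)) = g * g.
Proof.
move=> gs gN g1; have [hom act1 actM] := act.
set h := alpha 1%R in gN; have hh : unital_star_hom h by exact: hom.
have ggs : (g * g)^*s = g * g by rewrite starMr gs.
have gg1 : nrm (g * g) <= 1 by rewrite nrm_sqr // expr_le1 ?nrm_ge0.
have p1gg : posn (1 - g * g).
  split; first by rewrite starB star1 ggs.
  by exists 1 => //; rewrite scale1r subKr.
have y1 : nrm (1 - g * g) <= 1.
  apply: nrm_le_posn => //; first by case: p1gg.
    by rewrite scale1r subKr; exact: posn_sqr.
  by rewrite scale1r; apply: posnD => //; exact: posn1.
(* This is the absolute value of g; the action fixes it because it fixes g^2. *)
pose r := sqrt1B (1 - g * g).
have rs : r^*s = r by apply: sqrt1B_star => //; case: p1gg.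
have rr : r * r = g * g by rewrite sqrt1B_sqr // subKr.
have gr : g * r = r * g.
  by apply: sqrt1B_comm => //; apply: commrB; [exact: commr1|exact: commrM].
have hr : h r = r.
  rewrite star_hom_sqrt1B // (star_homB hh) (star_hom1 hh) (star_homM hh) gN.
  by rewrite mulrNN.
move: (r) rs rr gr hr => {}r rs rr gr hr.
pose gp : A := (2^-1)%:C%C *: (r + g); pose gm : A := (2^-1)%:C%C *: (r - g).
have gps : gp^*s = gp by rewrite starZr starD rs gs.
have gms : gm^*s = gm by rewrite starZr starB rs gs.
have hgp : h gp = gm by rewrite (star_homZ hh) (star_homD hh) hr gN.
have hgm : h gm = gp by rewrite (star_homZ hh) (star_homB hh) hr gN opprK.
have pm : gp * gm = 0.
  rewrite scaleAl scaleAr mulrDl !mulrBr rr gr.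
  by rewrite addrA subrK subrr !scaler0.
have mp : gm * gp = 0 
  by rewrite -(star_hom0 hh) -pm (star_homM hh) hgp hgm.
pose a := gp * gp; pose b := gm * gm.
have ab : a * b = 0 by rewrite /a /b -mulrA (mulrA gp gm) pm mul0r mulr0.
have ba : b * a = 0 by rewrite /a /b -mulrA (mulrA gm gp) mp mul0r mulr0.
have gE : gp - gm = g.
  rewrite -scalerBr opprB addrC addrA subrK -mulr2n -(scaler_nat 2 g) scalerA.
  rewrite -(rmorph_nat (real_complex R)) -rmorphM mulVf ?pnatr_eq0 //.
  exact: scale1r.
have aDb : a + b = g * g.
  by rewrite -gE mulrBl !mulrBr pm mp subr0 sub0r opprK.
have pa : posn a by exact: posn_sqr.
have pb : posn b by exact: posn_sqr.
(* Here 1 - a = (1 - g^2) + b, and symmetrically for b. *)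
have p1a : posn (1 - a).
  rewrite -(addrK b a) aDb opprB addrC -addrA [- _ + _]addrC.
  exact: posnD.
have p1b : posn (1 - b).
  rewrite -(addKr a b) aDb opprD opprK [1 + _]addrCA.
  exact: posnD.
have ha : h a = b by rewrite (star_homM hh) hgp.
have hb : h b = a by rewrite (star_homM hh) hgm.
have [lina multa stara] := fcalc_star_hom pa p1a.
have [linb multb starb] := fcalc_star_hom pb p1b.
pose rho (f : {ffun 'Z_2 -> C0_itv R}) := fcalc a (f 0%R) + fcalc b (f 1%R).
have hF f : h (rho f) = fcalc b (f 0%R) + fcalc a (f 1%R).
  rewrite (star_homD hh) (fcalc_morph _ hh) ?ha //.
  by rewrite (fcalc_morph (a := b) _ hh) ?hb.
exists rho; split; last first.
  rewrite /rho /tensor !ffunE !scale1r.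
  by rewrite !fcalc_id // aDb.
split; first split.
- move=> c f f'; rewrite /rho !ffunE.
  by rewrite lina linb scalerDr addrACA.
- move=> f f'; rewrite /rho !ffunE multa multb.
  rewrite [RHS]mulrDl !mulrDr (fcalc_orthogonal _ _ pa p1a pb p1b ab).
  by rewrite (fcalc_orthogonal _ _ pb p1b pa p1a ba) addr0 add0r.
- by move=> f; rewrite /rho !ffunE stara starb starD.
move=> k f; have [->|->] : k = 0 \/ k = 1.
  by case: k => -[|[|//]] kP; [left|right]; exact/val_inj.
- rewrite act1 /rho !ffunE.
  by congr (fcalc a (f _) + fcalc b (f _)); exact/val_inj.
(* Translation by the generator exchanges f 0 and f 1, as [h] exchanges a and b. *)
- rewrite [RHS]hF /rho !ffunE addrC.
  by congr (fcalc b (f _) + fcalc a (f _)); exact/val_inj.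
Qed.

End OddElement.

(** Each g_i yields a homomorphism sending t (x) 1 to g_i^2; the sum of squares also supplies |g_i|
    <= 1. *)
Lemma LT_trivial_of_odd (R : realType) (A : cstarAlgType R)
    (alpha : 'Z_2 -> A -> A) m (g : 'I_m.+1 -> A) :
  cstar_action alpha -> (forall i, (g i)^*s = g i) ->
  (forall i, alpha 1%R (g i) = - g i) -> \sum_i g i * g i = 1 ->
  LT_trivial_in alpha m.
Proof.
move=> act gs gN g1.
have /choice[rho rhoP] i := equivariant_hom_of_odd act (gs i) (gN i)
  (nrm_le1_sum_sqr gs g1 i).
exists rho; split=> [i|]; first by have [] := rhoP i.
by rewrite -[RHS]g1; apply: eq_bigr => i _; have [_ ->] := rhoP i.
Qed.

(** * Real and imaginary parts of the sphere generators *)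

Section RealImaginary.
Variables (R : realType) (A : cstarAlgType R).
Implicit Types u v : A.

Lemma scale_mul_scale (s t : R[i]) u v :
  (s *: u) * (t *: v) = (s * t) *: (u * v).
Proof. by rewrite scaleAl scaleAr scalerA. Qed.

(** The squares of u and [u^*s] cancel between the two terms; u need not be normal, so both mixed
    products remain. *)
Lemma re_im_sqr u :
  (2^-1)%:C%C *: (u + u^*s) * ((2^-1)%:C%C *: (u + u^*s)) +
  (2^-1)%:C%C *: ('i%C *: (u^*s - u)) * ((2^-1)%:C%C *: ('i%C *: (u^*s - u))) =
  (2^-1)%:C%C *: (u * u^*s + u^*s * u).
Proof.
rewrite !scale_mul_scale (_ : 'i%C * 'i%C = -1) -?expr2 ?sqr_i //.
rewrite scaleN1r -scalerDr; move: (u^*s) => v.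
have -> : (u + v) ^+ 2 - (v - u) ^+ 2 = (u * v + v * u) *+ 2.
  rewrite !expr2 !mulrDl !mulrDr !mulrN !mulNr opprD opprB opprK.
  move: (u * u) (u * v) (v * u) (v * v) => a b c d.
  rewrite opprD opprK [c - d + _]addrC addrACA [a + b]addrC.
  by rewrite (addrACA b) (addrACA c) !subrr !addr0 mulrnDl !mulr2n.
rewrite -(scaler_nat 2 (_ + _)) scalerA -(rmorph_nat (real_complex R)).
rewrite -rmorphXn -rmorphM.
by congr (_%:C%C *: _); field.
Qed.

End RealImaginary.

Section EvenSphere.
Variables (R : realType) (A : cstarAlgType R) (n : nat) (q : R).
Variable (x : 'I_n.+1 -> A).

(** The relations pass to the quotient, and the generator of the ideal lies in the kernel. *)
Lemma even_qsphere_rel : is_even_qsphere q x ->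
  qsphere_rel q x /\ (x ord_max)^*s = x ord_max.
Proof.
move=> [B [z [p [[[r1 r2 r3 r4] _ _] [hp _] kerp pz]]]].
have pzs i : p (z i)^*s = (x i)^*s by rewrite (star_homS hp) pz.
have psum (P : pred 'I_n.+1) : p (\sum_(i | P i) z i ** (z i)^*s) =
    \sum_(i | P i) x i ** (x i)^*s.
  rewrite (big_morph p (star_homD hp) (star_hom0 hp)).
  by apply: eq_bigr => i _; rewrite !smulE (star_homM hp) pz pzs.
have pM u v : p (u ** v) = p u ** p v by exact: star_homM.
split; first split.
- by move=> i j ij; rewrite -!pz -!pM r1 // (star_homZ hp).
- by move=> i j ij; rewrite -!pzs -!pz -!pM r2 // (star_homZ hp).
- by move=> i; rewrite -psum -(star_homZ hp) -!pzs -!pz -!pM -(star_homD hp) r3.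
- by rewrite -psum r4 (star_hom1 hp).
have : closed_ideal_gen (z ord_max - (z ord_max)^*s)
    (z ord_max - (z ord_max)^*s) by move=> J [].
rewrite -kerp /= (star_homB hp) pzs pz => /eqP; rewrite subr_eq0.
by move=> /eqP.
Qed.

Let y j := \sum_(i < n.+1 | (j <= i)%N) x i ** (x i)^*s.
Let c j : R := ((1 + q ^+ 2) / 2) ^+ j.
Let re j := (2^-1)%:C%C *: (x (inord j) + (x (inord j))^*s).
Let im j := (2^-1)%:C%C *: ('i%C *: ((x (inord j))^*s - x (inord j))).

(** Index 2 j carries Re x_j and 2 j + 1 carries Im x_j; the range 0, ..., 2 n stops before Im x_n,
    which is 0 for self-adjoint x_n. *)
Definition odd_gen k : A :=
  (Num.sqrt (c k./2))%:C%C *: (if odd k then im k./2 else re k./2).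

Let imJ : ('i%C^*)%C = - 'i%C :> R[i].
Proof. by apply/eqP; rewrite eq_complex /= oppr0 !eqxx. Qed.

Lemma odd_gen_star k : (odd_gen k)^*s = odd_gen k.
Proof.
rewrite starZr; congr (_ *: _); case: ifP => _.
  by rewrite starZr starZ starB starK imJ scaleNr -scalerN opprB.
by rewrite starZr starD starK addrC.
Qed.

Lemma odd_gen_odd (h : A -> A) : unital_star_hom h ->
  (forall j, h (x j) = - x j) -> forall k, h (odd_gen k) = - odd_gen k.
Proof.
move=> hh hx k; rewrite (star_homZ hh) -scalerN; congr (_ *: _).
case: ifP => _; rewrite (star_homZ hh) -scalerN; congr (_ *: _).
  rewrite (star_homZ hh) -scalerN (star_homB hh) (star_homS hh) hx starN.
  by rewrite opprB opprK addrC.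
by rewrite (star_homD hh) (star_homS hh) hx starN opprD.
Qed.

Hypothesis rel : qsphere_rel q x.
Hypothesis xn : (x ord_max)^*s = x ord_max.

Lemma sum_sqr_odd_gen : \sum_(i < (2 * n).+1) odd_gen i * odd_gen i = 1.
Proof.
have [_ _ r3 r4] := rel.
have c0 j : 0 <= c j by rewrite exprn_ge0 // divr_ge0 // addr_ge0 ?sqr_ge0.
have y0 : y 0 = 1 by rewrite -[RHS]r4; apply: eq_bigl.
have yS j : (j <= n)%N -> y j = x (inord j) * (x (inord j))^*s + y j.+1.
  move=> jn; rewrite /y (bigD1 (inord j)) ?inordK //=; congr (_ + _).
  apply: eq_bigl => i; rewrite -(inj_eq val_inj) /= inordK //.
  by rewrite ltn_neqAle andbC eq_sym.
have yn1 : y n.+1 = 0.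
  by rewrite /y big_pred0 // => i; apply/negbTE; rewrite -ltnNge ltn_ord.
(* Half of x x^* + x^* x is x x^* + (1 - q^2) / 2 y_{j+1}, and x x^* = y_j - y_{j+1}. *)
have reim j : (j < n)%N ->
    re j * re j + im j * im j = y j - ((1 + q ^+ 2) / 2)%:C%C *: y j.+1.
  move=> jn; rewrite yS ?(ltnW jn) //; set u := x (inord j).
  have uu : u^*s * u = u * u^*s + (1 - q ^+ 2)%:C%C *: y j.+1.
    have := r3 (inord j); rewrite !smulE -/u => ->; congr (_ + _ *: _).
    by apply: eq_bigl => i; rewrite inordK // ltnS ltnW.
  rewrite /re /im -/u re_im_sqr uu addrA -mulr2n scalerDr scalerA -rmorphM.
  rewrite -(scaler_nat 2 (u * _)) scalerA -(rmorph_nat (real_complex R)).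
  rewrite -rmorphM mulVf ?pnatr_eq0 // scale1r -addrA; congr (_ + _).
  rewrite -{2}[y j.+1]scale1r -scalerBl -(rmorph1 (real_complex R)) -rmorphB.
  by congr (_%:C%C *: _); field.
have sqr_even j :
    odd_gen (2 * j) * odd_gen (2 * j) = (c j)%:C%C *: (re j * re j).
  rewrite /odd_gen mul2n odd_double doubleK scale_mul_scale -rmorphM -expr2.
  by rewrite (sqr_sqrtr (c0 j)).
have sqr_odd j :
    odd_gen (2 * j).+1 * odd_gen (2 * j).+1 = (c j)%:C%C *: (im j * im j).
  rewrite /odd_gen mul2n [(_.+1)./2]uphalf_double oddS odd_double.
  by rewrite scale_mul_scale -rmorphM -expr2 (sqr_sqrtr (c0 j)).
(* Multiplied by c_j, the identity [reim] reads c_j y_j - c_{j+1} y_{j+1}, which telescopes from y_0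
   = 1. *)
have partial j : (j <= n)%N ->
    \sum_(0 <= i < (2 * j)%N) odd_gen i * odd_gen i = 1 - (c j)%:C%C *: y j.
  elim: j => [_|j IH jn]; first by rewrite big_geq // y0 /c expr0 scale1r subrr.
  rewrite mulnS !big_nat_recr //= IH ?(ltnW jn) // sqr_even sqr_odd.
  rewrite -addrA -scalerDr reim // scalerBr addrA subrK scalerA -rmorphM.
  by rewrite /c [_ ^+ j.+1]exprSr.
(* The last term c_n x_n^2 = c_n y_n cancels the remainder. *)
rewrite -(big_mkord xpredT (fun i => odd_gen i * odd_gen i)) big_nat_recr //=.
rewrite partial // sqr_even yS // yn1 addr0.
have -> : re n = x ord_max.
  rewrite /re (_ : inord n = ord_max); last by apply/val_inj; rewrite /= inordK.
  rewrite xn -mulr2n -(scaler_nat 2 (x _)) scalerA.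
  rewrite -(rmorph_nat (real_complex R)) -rmorphM mulVf ?pnatr_eq0 //.
  exact: scale1r.
rewrite (_ : inord n = ord_max); last by apply/val_inj; rewrite /= inordK.
by rewrite xn subrK.
Qed.

End EvenSphere.

Theorem proposition5p15 (R : realType) (n : nat) (hn : (1 <= n)%N)
    (q : R) (hq0 : 0 < q) (hq1 : q < 1)
    (A : cstarAlgType R) (x : 'I_n.+1 -> A) (hA : is_even_qsphere q x)
    (alpha : 'Z_2 -> A -> A) (halpha : antipodal_action x alpha) :
  (dim_LT alpha <= ((2 * n)%N%:R)%:E)%E.
Proof.
have [rel xn] := even_qsphere_rel hA; have [act alphaN] := halpha.
apply: ereal_inf_lbound; exists (2 * n)%N => //=.
apply: (LT_trivial_of_odd (g := fun i => odd_gen q x i)) => // [i|i|].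
- exact: odd_gen_star.
- by apply: odd_gen_odd => //; case: act.
- exact: sum_sqr_odd_gen.
Qed.
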